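(* Let $\mathcal{A}$ be a symmetric Frobenius algebra over a commutative ring $\mathbb{K}$ with Frobenius pairing $(-,-)$. For any $\alpha\in\mathcal{A}^*$, there is a unique $\overline\alpha\in\mathcal{A}$ such that $\alpha(a)=(a,\overline\alpha)$ for all $a\in\mathcal{A}$. The map $\mathcal{A}^*\to\mathcal{A}$, $\alpha\mapsto\overline\alpha$, is a cyclic structure on the algebra $\mathcal{A}$ and on the dual coalgebra $\mathcal{A}^*$. The associated cyclic bilinear form $v$ on $\mathcal{A}^*$ is given by $v(\alpha\otimes\beta)=\beta(\overline\alpha)=(\overline\alpha,\overline\beta)$ for any $\alpha,\beta\in\mathcal{A}^*$.
   Context: All modules, algebras, coalgebras are over a fixed commutative ring $\mathbb{K}$; algebras are associative, not necessarily unital; coalgebras are coassociative, not necessarily counital. $\mathcal{A}^*=\mathrm{Hom}_{\mathbb{K}}(\mathcal{A},\mathbb{K})$. Frobenius algebra: a pair consisting of an algebra $\mathcal{A}$ whose underlying module is free of finite rank and a bilinear form $(-,-):\mathcal{A}\times\mathcal{A}\to\mathbb{K}$ (the Frobenius pairing) which is non-degenerate (its left adjoint map $\mathcal{A}\to\mathcal{A}^*$ is an isomorphism) and satisfies $(ab,c)=(a,bc)$ for all $a,b,c$. It is symmetric if $(a,b)=(b,a)$ for all $a,b$. Dual coalgebra: for $\mathcal{A}$ free of finite rank, $\mathcal{A}^*$ has comultiplication $\mu(\alpha)=\alpha^1\otimes\alpha^2$ (summation suppressed) determined by $\alpha^1(a)\alpha^2(b)=\alpha(ab)$; iterated comultiplication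 is written $\alpha^1\otimes\alpha^2\otimes\alpha^3$, etc. One identifies $(\mathcal{A}^{*})^*$ with $\mathcal{A}$ via evaluation. Cyclic structure on an algebra $\mathcal{A}$: a linear map $\mathcal{A}^*\to\mathcal{A}$, $\alpha\mapsto\overline\alpha$, such that $\alpha(a\overline\beta b)=\beta(b\overline\alpha a)$ for all $\alpha,\beta\in\mathcal{A}^*$, $a,b\in\mathcal{A}$. Cyclic structure on a coalgebra $M$: a linear map $M\to M^*$, $\alpha\mapsto\overline\alpha$, such that $\overline\alpha(\beta^2)\,\beta^1\otimes\beta^3=\overline\beta(\alpha^2)\,\alpha^3\otimes\alpha^1$ for all $\alpha,\beta\in M$. Cyclic bilinear form on a coalgebra $M$: a bilinear form $v:M\otimes M\to\mathbb{K}$ such that the map $\widehat v:M\otimes M\to M\otimes M$, $\widehat v(\alpha\otimes\beta)=v(\alpha\otimes\beta^2)\beta^1\otimes\beta^3$, commutes with the flip of the tensor factors. The cyclic bilinear form associated with a cyclic structure $M\to M^*$, $\alpha\mapsto\overline\alpha$, is $v(\alpha\otimes\beta)=\overline\alpha(\beta)$ (for $M=\mathcal{A}^*$, with $M^*=\mathcal{A}$, this value is $\beta(\overline\alpha)$). *)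

(* Defs.v *)
From HB Require Import structures.
From mathcomp Require Import all_boot all_algebra generic_quotient.
From mathcomp Require Import boolp.

Set Implicit Arguments.
Unset Strict Implicit.
Unset Printing Implicit Defensive.

Import GRing.Theory.
Local Open Scope ring_scope.
Local Open Scope quotient_scope.

Section LinearMaps.
Variables (K : pzRingType) (U V W : lmodType K).

Definition mk_linear (f : U -> V) (hf : linear f) : {linear U -> V} :=
  HB.pack f (GRing.isLinear.Build K U V *:%R f hf).

Lemma linear_ext (f g : {linear U -> V}) : f =1 g -> f = g.
Proof.
move=> /funext; case: f g => [f [[f1] [f2]]] [g [[g1] [g2]]] /= fg.
by subst g; rewrite (Prop_irrelevance f1 g1) (Prop_irrelevance f2 g2).
Qed.

(* The library's {bilinear _ -> _ -> _} is only available over nonzero rings. *)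
Definition is_bilinear (f : U -> V -> W) : Prop :=
  (forall v, linear (f^~ v)) /\ (forall u, linear (f u)).

End LinearMaps.

Section Dual.
Variables (K : comPzRingType) (M : lmodType K).

Definition dual : Type := {linear M -> K^o}.

HB.instance Definition _ := gen_eqMixin dual.
HB.instance Definition _ := gen_choiceMixin dual.

Definition dual_zero : dual := @GRing.null_fun M K^o.
Definition dual_opp (f : dual) : dual := \- (f : {linear M -> K^o}).
Definition dual_add (f g : dual) : dual :=
  (f : {linear M -> K^o}) \+ (g : {linear M -> K^o}).
Definition dual_scale (k : K) (f : dual) : dual :=
  k \*: (f : {linear M -> K^o}).

Fact dual_addA : associative dual_add.
Proof. by move=> f g h; apply: linear_ext => x /=; rewrite addrA. Qed.
Fact dual_addC : commutative dual_add.
Proof. by move=> f g; apply: linear_ext => x /=; rewrite addrC. Qed.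
Fact dual_add0 : left_id dual_zero dual_add.
Proof. by move=> f; apply: linear_ext => x /=; rewrite add0r. Qed.
Fact dual_addN : left_inverse dual_zero dual_opp dual_add.
Proof. by move=> f; apply: linear_ext => x /=; rewrite addNr. Qed.
HB.instance Definition _ :=
  GRing.isZmodule.Build dual dual_addA dual_addC dual_add0 dual_addN.

Fact dual_scaleA (a b : K) (f : dual) :
  dual_scale a (dual_scale b f) = dual_scale (a * b) f.
Proof. by apply: linear_ext => x /=; rewrite scalerA. Qed.
Fact dual_scale1 : left_id 1 dual_scale.
Proof. by move=> f; apply: linear_ext => x /=; rewrite scale1r. Qed.
Fact dual_scaleDr : right_distributive dual_scale +%R.
Proof. by move=> a f g; apply: linear_ext => x /=; rewrite scalerDr. Qed.
Fact dual_scaleDl (f : dual) : {morph dual_scale^~ f : a b / a + b}.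
Proof. by move=> a b; apply: linear_ext => x /=; rewrite scalerDl. Qed.
HB.instance Definition _ := GRing.Zmodule_isLmodule.Build K dual
  dual_scaleA dual_scale1 dual_scaleDr dual_scaleDl.

Lemma dual_ext (f g : dual) : f =1 g -> f = g.
Proof. exact: linear_ext. Qed.
Lemma dual0E x : (0 : dual) x = 0. Proof. by []. Qed.
Lemma dualDE (f g : dual) x : (f + g) x = f x + g x. Proof. by []. Qed.
Lemma dualZE (k : K) (f : dual) x : (k *: f) x = k * f x. Proof. by []. Qed.
Lemma dual_sumE I (r : seq I) (P : pred I) (F : I -> dual) x :
  (\sum_(i <- r | P i) F i) x = \sum_(i <- r | P i) F i x.
Proof.
by apply: (big_ind2 (fun (f : dual) y => f x = y)) => // f1 ? f2 ? <- <-.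
Qed.

End Dual.

Section Tensor.
Variables (K : comPzRingType) (U V : lmodType K).

(* A list of pairs stands for the formal sum of the corresponding u ⊗ v. *)
Inductive tcong : seq (U * V) -> seq (U * V) -> Prop :=
| tcong_refl s : tcong s s
| tcong_sym s t : tcong s t -> tcong t s
| tcong_trans s t r : tcong s t -> tcong t r -> tcong s r
| tcong_cat s1 t1 s2 t2 :
    tcong s1 t1 -> tcong s2 t2 -> tcong (s1 ++ s2) (t1 ++ t2)
| tcong_comm s t : tcong (s ++ t) (t ++ s)
| tcong_nil v : tcong [:: (0, v)] [::]
| tcong_addl u1 u2 v : tcong [:: (u1 + u2, v)] [:: (u1, v); (u2, v)]
| tcong_addr u v1 v2 : tcong [:: (u, v1 + v2)] [:: (u, v1); (u, v2)]
| tcong_scale (k : K) u v : tcong [:: (k *: u, v)] [:: (u, k *: v)].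

Definition trel : rel (seq (U * V)) := fun s t => `[< tcong s t >].

Fact trel_refl : reflexive trel.
Proof. by move=> s; apply/asboolP; constructor. Qed.
Fact trel_sym : symmetric trel.
Proof. by move=> s t; apply/asboolP/asboolP => h; apply: tcong_sym. Qed.
Fact trel_trans : transitive trel.
Proof.
by move=> s t r /asboolP h1 /asboolP h2; apply/asboolP; apply: tcong_trans h2.
Qed.
Canonical trel_equiv := EquivRel trel trel_refl trel_sym trel_trans.

Definition tensor : Type := {eq_quot trel}.

HB.instance Definition _ := Choice.on tensor.
HB.instance Definition _ := EqQuotient.on tensor.

Definition tpi (s : seq (U * V)) : tensor := \pi_tensor s.
Definition trepr (x : tensor) : seq (U * V) := repr x.

Lemma treprK x : tpi (trepr x) = x.
Proof. exact: reprK. Qed.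
Lemma tpiP s t : tpi s = tpi t <-> tcong s t.
Proof.
split=> [/eqmodP/asboolP //|h].
by apply/eqmodP/asboolP.
Qed.
Lemma trepr_tpi s : tcong (trepr (tpi s)) s.
Proof. by apply/tpiP; rewrite treprK. Qed.

Definition sscale (k : K) (s : seq (U * V)) := [seq (k *: p.1, p.2) | p <- s].

Lemma tcong_sscale k s t : tcong s t -> tcong (sscale k s) (sscale k t).
Proof.
rewrite /sscale; elim=> {s t} /=.
- by move=> s; constructor.
- by move=> s t _; apply: tcong_sym.
- by move=> s t r _ h1 _ h2; apply: tcong_trans h2.
- by move=> s1 t1 s2 t2 _ h1 _ h2; rewrite !map_cat; apply: tcong_cat.
- by move=> s t; rewrite !map_cat; apply: tcong_comm.
- by move=> v; rewrite scaler0; constructor.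
- by move=> u1 u2 v; rewrite scalerDr; constructor.
- by move=> u v1 v2; constructor.
- by move=> l u v; rewrite scalerA mulrC -scalerA; constructor.
Qed.

Definition tzero : tensor := tpi [::].
Definition tadd (x y : tensor) : tensor := tpi (trepr x ++ trepr y).
Definition tscale (k : K) (x : tensor) : tensor := tpi (sscale k (trepr x)).
Definition topp (x : tensor) : tensor := tscale (-1) x.

Lemma tadd_pi s t : tadd (tpi s) (tpi t) = tpi (s ++ t).
Proof. by apply/tpiP; apply: tcong_cat; apply: trepr_tpi. Qed.
Lemma tscale_pi k s : tscale k (tpi s) = tpi (sscale k s).
Proof. by apply/tpiP; apply: tcong_sscale; apply: trepr_tpi. Qed.

Lemma tensorW (P : tensor -> Prop) : (forall s, P (tpi s)) -> forall x, P x.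
Proof. by move=> h x; rewrite -(treprK x). Qed.

Lemma sscaleDl k l s : tcong (sscale (k + l) s) (sscale k s ++ sscale l s).
Proof.
elim: s => [|[u v] s IH] /=; first by constructor.
apply: (@tcong_trans _ (([:: (k *: u, v)] ++ [:: (l *: u, v)]) ++
  (sscale k s ++ sscale l s))).
  apply: (tcong_cat (s1 := [:: ((k + l) *: u, v)])) => //.
  by rewrite scalerDl; apply: tcong_addl.
apply: (tcong_cat (s1 := [:: (k *: u, v)]) (t1 := [:: (k *: u, v)])).
  exact: tcong_refl.
rewrite -cat_rcons -cats1.
apply: (tcong_cat (s1 := [:: (l *: u, v)] ++ sscale k s)).
  exact: tcong_comm.
exact: tcong_refl.
Qed.

Lemma sscale0 s : tcong (sscale 0 s) [::].
Proof.
elim: s => [|[u v] s IH] /=; first by constructor.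
apply: (tcong_cat (s1 := [:: (0 *: u, v)]) (t1 := [::])) => //.
by rewrite scale0r; constructor.
Qed.

Lemma sscale1 s : sscale 1 s = s.
Proof. by elim: s => [|[u v] s IH] //=; rewrite IH scale1r. Qed.

Fact taddA : associative tadd.
Proof.
elim/tensorW=> s; elim/tensorW=> t; elim/tensorW=> r.
by rewrite !tadd_pi catA.
Qed.
Fact taddC : commutative tadd.
Proof.
elim/tensorW=> s; elim/tensorW=> t; rewrite !tadd_pi.
by apply/tpiP; constructor.
Qed.
Fact tadd0 : left_id tzero tadd.
Proof. by elim/tensorW=> s; rewrite tadd_pi. Qed.
Fact taddN : left_inverse tzero topp tadd.
Proof.
elim/tensorW=> s; rewrite /topp tscale_pi tadd_pi; apply/tpiP.
rewrite -{2}(sscale1 s); apply: tcong_trans (tcong_sym (sscaleDl _ _ _)) _.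
by rewrite addNr; apply: sscale0.
Qed.
HB.instance Definition _ := GRing.isZmodule.Build tensor taddA taddC tadd0 taddN.

Fact tscaleA (a b : K) (x : tensor) : tscale a (tscale b x) = tscale (a * b) x.
Proof.
elim/tensorW: x => s; rewrite !tscale_pi; congr tpi.
by rewrite /sscale -map_comp; apply: eq_map => p /=; rewrite scalerA.
Qed.
Fact tscale1 : left_id 1 tscale.
Proof. by elim/tensorW=> s; rewrite tscale_pi sscale1. Qed.
Fact tscaleDr : right_distributive tscale +%R.
Proof.
move=> a; elim/tensorW=> s; elim/tensorW=> t.
by rewrite [tpi s + _]tadd_pi !tscale_pi [_ + _]tadd_pi /sscale map_cat.
Qed.
Fact tscaleDl (x : tensor) : {morph tscale^~ x : a b / a + b}.
Proof.
elim/tensorW: x => s a b; rewrite !tscale_pi [tpi _ + _]tadd_pi.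
by apply/tpiP; apply: sscaleDl.
Qed.
HB.instance Definition _ := GRing.Zmodule_isLmodule.Build K tensor
  tscaleA tscale1 tscaleDr tscaleDl.

Definition tens (u : U) (v : V) : tensor := tpi [:: (u, v)].

Lemma tens_bilinear : is_bilinear tens.
Proof.
split=> [v k u1 u2|u k v1 v2] /=.
  rewrite /tens [_ *: tpi _]tscale_pi [tpi _ + _]tadd_pi; apply/tpiP; exact: tcong_addl.
rewrite /tens [_ *: tpi _]tscale_pi [tpi _ + _]tadd_pi; apply/tpiP.
apply: tcong_trans (tcong_addr _ _ _) _ => /=.
apply: (tcong_cat (s1 := [:: (u, k *: v1)]) (t1 := [:: (k *: u, v1)])).
  exact: tcong_sym (tcong_scale _ _ _).
exact: tcong_refl.
Qed.

Lemma tpiE s : tpi s = \sum_(p <- s) tens p.1 p.2.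
Proof.
elim: s => [|[u v] s IH]; first by rewrite big_nil.
by rewrite big_cons -IH [tens _ _ + _]tadd_pi.
Qed.

Lemma tensor_ind (P : tensor -> Prop) :
  P 0 -> (forall x y, P x -> P y -> P (x + y)) -> (forall u v, P (tens u v)) ->
  forall x, P x.
Proof. by move=> P0 PD Pt; elim/tensorW=> s; rewrite tpiE; apply: big_ind. Qed.

Section Lift.
Variables (W : lmodType K) (f : U -> V -> W) (hf : is_bilinear f).

Definition tlift_fun (x : tensor) : W := \sum_(p <- trepr x) f p.1 p.2.

Lemma tlift_pi s : tlift_fun (tpi s) = \sum_(p <- s) f p.1 p.2.
Proof.
pose fl v := mk_linear (hf.1 v); pose fr u := mk_linear (hf.2 u).
have flE u v : f u v = fl v u by [].
have frE u v : f u v = fr u v by [].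
rewrite /tlift_fun; move: (trepr_tpi s); move: (trepr _) => r.
elim=> {r s} //.
- by move=> s t r _ -> _ ->.
- by move=> s1 t1 s2 t2 _ h1 _ h2; rewrite !big_cat h1 h2.
- by move=> s t; rewrite !big_cat /= addrC.
- by move=> v; rewrite big_seq1 big_nil flE linear0.
- by move=> u1 u2 v; rewrite !big_cons !big_nil !addr0 !flE linearD.
- by move=> u v1 v2; rewrite !big_cons !big_nil !addr0 !frE linearD.
- by move=> k u v; rewrite !big_seq1 flE linearZ frE linearZ.
Qed.

Fact tlift_linear : linear tlift_fun.
Proof.
move=> k; elim/tensorW=> s; elim/tensorW=> t.
rewrite [_ *: _]tscale_pi [tpi _ + _]tadd_pi !tlift_pi big_cat; congr (_ + _).
rewrite /sscale big_map scaler_sumr; apply: eq_bigr => p _ /=.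
exact: (linearZZ (mk_linear (hf.1 p.2))).
Qed.

Definition tlift : {linear tensor -> W} := mk_linear tlift_linear.

Lemma tliftE u v : tlift (tens u v) = f u v.
Proof. by rewrite /tlift /= tlift_pi big_seq1. Qed.

End Lift.

Lemma tensor_linear_ext (W : lmodType K) (f g : {linear tensor -> W}) :
  (forall u v, f (tens u v) = g (tens u v)) -> f =1 g.
Proof.
move=> fg; elim/tensor_ind => [|x y|//]; first by rewrite !linear0.
by rewrite !linearD => -> ->.
Qed.

End Tensor.

Notation "U ⊗ V" := (tensor U V) (at level 40, left associativity) : type_scope.

Section TensorMaps.
Variable K : comPzRingType.

Fact tmap_bilinear (U U' V V' : lmodType K)
  (f : {linear U -> U'}) (g : {linear V -> V'}) :
  is_bilinear (fun u v => tens (f u) (g v)).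
Proof.
by split=> [v k x y|u k x y] /=; rewrite linearP;
  [apply: (tens_bilinear _ _).1|apply: (tens_bilinear _ _).2].
Qed.
Definition tmap (U U' V V' : lmodType K)
    (f : {linear U -> U'}) (g : {linear V -> V'}) : {linear U ⊗ V -> U' ⊗ V'} :=
  tlift (tmap_bilinear f g).

Fact tflip_bilinear (U V : lmodType K) :
  is_bilinear (fun (u : U) (v : V) => tens v u).
Proof.
split=> [v k x y|u k x y] /=;
  [exact: (tens_bilinear _ _).2|exact: (tens_bilinear _ _).1].
Qed.
Definition tflip (U V : lmodType K) : {linear U ⊗ V -> V ⊗ U} :=
  tlift (@tflip_bilinear U V).

Fact tassoc1_bilinear (U V W : lmodType K) (w : W) :
  is_bilinear (fun (u : U) (v : V) => tens u (tens v w)).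
Proof.
split=> [v k x y|u k x y] /=; first exact: (tens_bilinear _ _).1.
by rewrite (tens_bilinear _ _).1 (tens_bilinear _ _).2.
Qed.
Fact tassoc_bilinear (U V W : lmodType K) :
  is_bilinear (fun (x : U ⊗ V) (w : W) => tlift (@tassoc1_bilinear U V W w) x).
Proof.
split=> [w k x y|x k w1 w2]; 
  first exact: (tlift_linear (@tassoc1_bilinear U V W w)).
elim/tensor_ind: x => [|x y hx hy|u v]; first by rewrite !linear0 ?scaler0 addr0.
  by rewrite !linearD hx hy ?scalerDr addrACA.
by rewrite !tliftE (tens_bilinear _ _).2 (tens_bilinear _ _).2.
Qed.
Definition tassoc (U V W : lmodType K) : {linear (U ⊗ V) ⊗ W -> U ⊗ (V ⊗ W)} :=
  tlift (@tassoc_bilinear U V W).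

Lemma tmapE (U U' V V' : lmodType K) (f : {linear U -> U'})
  (g : {linear V -> V'}) u v : tmap f g (tens u v) = tens (f u) (g v).
Proof. exact: tliftE. Qed.
Lemma tflipE (U V : lmodType K) (u : U) (v : V) : tflip U V (tens u v) = tens v u.
Proof. exact: tliftE. Qed.
Lemma tassocE (U V W : lmodType K) (u : U) (v : V) (w : W) :
  tassoc U V W (tens (tens u v) w) = tens u (tens v w).
Proof. by rewrite !tliftE. Qed.

(* u ⊗ v |-> f u * g v *)
Fact tpair_bilinear (U V : lmodType K) (f : dual U) (g : dual V) :
  is_bilinear (fun u v => f u * g v : K^o).
Proof.
split=> [v k x y|u k x y] /=; rewrite linearP.
  by rewrite mulrDl; congr (_ + _); exact: (esym (mulrA _ _ _)).
by rewrite mulrDr; congr (_ + _); exact: (mulrCA _ _ _).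
Qed.
Definition tpair (U V : lmodType K) (f : dual U) (g : dual V) : dual (U ⊗ V) :=
  tlift (tpair_bilinear f g).
Lemma tpairE (U V : lmodType K) (f : dual U) (g : dual V) u v :
  tpair f g (tens u v) = f u * g v.
Proof. exact: tliftE. Qed.

(* x ⊗ y ⊗ z |-> f y *: x ⊗ z *)
Fact tact_bilinear (U V : lmodType K) (f : dual U) :
  is_bilinear (fun (u : U) (v : V) => f u *: v).
Proof.
split=> [v k x y|u k x y] /=.
  by rewrite linearP scalerDl scalerA.
by rewrite scalerDr !scalerA mulrC.
Qed.
Definition contract2 (U V W : lmodType K) (f : dual V) :
    {linear U ⊗ (V ⊗ W) -> U ⊗ W} :=
  tmap idfun (tlift (@tact_bilinear V W f)).
Arguments contract2 {U V W} f.
Lemma contract2E (U V W : lmodType K) (f : dual V) (u : U) (v : V) (w : W) :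
  contract2 f (tens u (tens v w)) = (f v : K) *: tens u w.
Proof.
rewrite tmapE tliftE /=.
exact: (linearZZ (mk_linear ((tens_bilinear U W).2 u))).
Qed.

(* [contract2 f] depends linearly on f. *)
Lemma contract2P (U V W : lmodType K) (k : K) (f g : dual V)
    (x : U ⊗ (V ⊗ W)) :
  contract2 (k *: f + g) x = k *: contract2 f x + contract2 g x.
Proof.
elim/tensor_ind: x => [|x y hx hy|u t]; first by rewrite !linear0 ?scaler0 addr0.
  by rewrite !linearD hx hy ?scalerDr addrACA.
elim/tensor_ind: t => [|x y|v w].
- have -> : tens u (0 : V ⊗ W) = 0.
    exact: (linear0 (mk_linear ((tens_bilinear U (V ⊗ W)).2 u))).
  by rewrite !linear0 ?scaler0 addr0.
- have -> : tens u (x + y) = tens u x + tens u y.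
    exact: (linearD (mk_linear ((tens_bilinear U (V ⊗ W)).2 u))).
  by move=> hx hy; rewrite !linearD hx hy ?scalerDr addrACA.
- by rewrite !contract2E dualDE dualZE scalerDl scalerA.
Qed.

End TensorMaps.
Arguments contract2 {K U V W} f.

Section Evaluation.
Variables (K : comPzRingType) (M : lmodType K).

Fact ev1_linear (x : M) : linear (fun f : dual M => f x : K^o).
Proof. by []. Qed.
Definition ev1 (x : M) : dual (dual M) := mk_linear (ev1_linear x).
Fact ev_linear : linear ev1.
Proof. by move=> k x y; apply: dual_ext => f; rewrite /= linearP. Qed.
(* The canonical map M -> M^**. *)
Definition ev : {linear M -> dual (dual M)} := mk_linear ev_linear.

Lemma evE x f : ev x f = f x. Proof. by []. Qed.

End Evaluation.

Section Coalgebras.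
Variable K : comPzRingType.

(* Not necessarily counital. *)
Record coalgebra := Coalgebra {
  coalg_mod :> lmodType K;
  comul : {linear coalg_mod -> coalg_mod ⊗ coalg_mod};
  comulA : forall x,
    tassoc _ _ _ (tmap comul idfun (comul x)) = tmap idfun comul (comul x) }.

Variable M : coalgebra.

(* x |-> x^1 ⊗ x^2 ⊗ x^3 *)
Definition comul3 : {linear M -> M ⊗ (M ⊗ M)} := tmap idfun (comul M) \o comul M.

(* bar alpha (beta^2) beta^1 ⊗ beta^3 = bar beta (alpha^2) alpha^3 ⊗ alpha^1 *)
Definition cyclic_coalgebra_structure (bar : {linear M -> dual M}) : Prop :=
  forall alpha beta : M,
    contract2 (bar alpha) (comul3 beta) =
    tflip M M (contract2 (bar beta) (comul3 alpha)).

Fact slice_linear (v : {linear M ⊗ M -> K^o}) (alpha : M) :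
  linear (fun beta => v (tens alpha beta)).
Proof. by move=> k x y; rewrite (tens_bilinear _ _).2 linearP. Qed.
Definition slice (v : {linear M ⊗ M -> K^o}) (alpha : M) : dual M :=
  mk_linear (slice_linear v alpha).

Fact vhat_bilinear (v : {linear M ⊗ M -> K^o}) :
  is_bilinear (fun alpha beta => contract2 (slice v alpha) (comul3 beta)).
Proof.
split=> [beta k x y|alpha k x y]; last by rewrite (linearP comul3) linearP.
rewrite -contract2P; congr (contract2 _ _); apply: dual_ext => z /=.
by rewrite (tens_bilinear _ _).1 linearP.
Qed.
(* alpha ⊗ beta |-> v (alpha ⊗ beta^2) beta^1 ⊗ beta^3 *)
Definition vhat (v : {linear M ⊗ M -> K^o}) : {linear M ⊗ M -> M ⊗ M} :=
  tlift (vhat_bilinear v).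

Definition cyclic_bilinear_form (v : {linear M ⊗ M -> K^o}) : Prop :=
  forall x, vhat v (tflip M M x) = tflip M M (vhat v x).

Fact form_of_bilinear (bar : {linear M -> dual M}) :
  is_bilinear (fun alpha beta => bar alpha beta : K^o).
Proof. by split=> [beta k x y|alpha k x y]; rewrite linearP. Qed.
(* The cyclic bilinear form associated with a cyclic structure bar. *)
Definition form_of (bar : {linear M -> dual M}) : {linear M ⊗ M -> K^o} :=
  tlift (form_of_bilinear bar).

End Coalgebras.

Section Algebras.
Variable K : comPzRingType.

(* Not necessarily unital. *)
Record algebra := Algebra {
  alg_mod :> lmodType K;
  amul : alg_mod -> alg_mod -> alg_mod;
  amul_bilinear : is_bilinear amul;
  amulA : associative amul }.

Definition free_finite_rank (M : lmodType K) : Prop :=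
  exists (n : nat) (f : {linear M -> 'rV[K]_n}), bijective f.

Definition cyclic_algebra_structure (A : algebra) (bar : {linear dual A -> A}) :
    Prop :=
  forall (alpha beta : dual A) (a b : A),
    alpha (amul (amul a (bar beta)) b) = beta (amul (amul b (bar alpha)) a).

Fact adjoint_linear (M : lmodType K) (p : M -> M -> K^o) (hp : is_bilinear p) a :
  linear (p a).
Proof. exact: hp.2. Qed.
Definition left_adjoint (M : lmodType K) (p : M -> M -> K^o)
  (hp : is_bilinear p) (a : M) : dual M := mk_linear (adjoint_linear hp a).

Record frobenius_algebra := FrobeniusAlgebra {
  frob_alg :> algebra;
  frob_free : free_finite_rank frob_alg;
  pairing : frob_alg -> frob_alg -> K^o;
  pairing_bilinear : is_bilinear pairing;
  pairing_nondegenerate : bijective (left_adjoint pairing_bilinear);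
  pairing_invariant : forall a b c, pairing (amul a b) c = pairing a (amul b c) }.

Definition symmetric_frobenius (A : frobenius_algebra) : Prop :=
  forall a b : A, pairing a b = pairing b a.

End Algebras.

Section Coordinates.
Variable K : comPzRingType.

Definition coords (M : lmodType K) (I : finType) (e : I -> M) (c : I -> dual M) :=
  forall x, x = \sum_i (c i x : K) *: e i.

Lemma free_coords (M : lmodType K) : free_finite_rank M ->
  exists n (e : 'I_n -> M) (c : 'I_n -> dual M), coords e c.
Proof.
case=> n [f [g fK gK]].
have hc i : linear (fun x => f x 0 i : K^o).
  by move=> k x y; rewrite linearP !mxE.
exists n, (fun i => g (delta_mx 0 i)), (fun i => mk_linear (hc i)) => x.
apply: (can_inj fK); rewrite linear_sum [LHS]row_sum_delta.
by apply: eq_bigr => i _; rewrite linearZ gK.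
Qed.

Lemma coords_dual (M : lmodType K) (I : finType) (e : I -> M) (c : I -> dual M) :
  coords e c -> coords c (fun i => ev M (e i)).
Proof.
move=> ec f; apply: dual_ext => x; rewrite dual_sumE {1}(ec x) linear_sum.
by apply: eq_bigr => i _; rewrite linearZ dualZE evE; apply: mulrC.
Qed.

Lemma coords_tensor (U V : lmodType K)
    (I : finType) (e : I -> U) (c : I -> dual U)
    (J : finType) (e' : J -> V) (c' : J -> dual V) :
  coords e c -> coords e' c' ->
  coords (fun p : I * J => tens (e p.1) (e' p.2))
         (fun p => tpair (c p.1) (c' p.2)).
Proof.
move=> ec ec'; elim/tensor_ind => [|s t hs ht|u v].
- by rewrite big1 // => p _; rewrite linear0 scale0r.
- rewrite {1}hs {1}ht -big_split; apply: eq_bigr => p _.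
  by rewrite linearD scalerDl.
- pose l w := mk_linear ((tens_bilinear U V).1 w).
  pose r w := mk_linear ((tens_bilinear U V).2 w).
  rewrite -(pair_bigA _ (fun i j =>
    (tpair (c i) (c' j) (tens u v) : K) *: tens (e i) (e' j))) /=.
  rewrite {1}(ec u) -[LHS]/(l v _) linear_sum; apply: eq_bigr => i _.
  rewrite linearZZ -[l v _]/(r (e i) v) {1}(ec' v) linear_sum.
  rewrite scaler_sumr; apply: eq_bigr => j _.
  by rewrite linearZZ scalerA -[tlift_fun _ _]/(tpair (c i) (c' j) _) tpairE.
Qed.

Lemma coords_sep (M : lmodType K) (I : finType) (e : I -> M) (c : I -> dual M)
    (x y : M) :
  coords e c -> (forall i, c i x = c i y) -> x = y.
Proof. by move=> ec h; rewrite [x]ec [y]ec; apply: eq_bigr => i _; rewrite h. Qed.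

End Coordinates.

Section DualCoalgebra.
Variables (K : comPzRingType) (A : algebra K) (hA : free_finite_rank A).

(* alpha^1(a) * alpha^2(b), for t = alpha^1 ⊗ alpha^2 *)
Definition ev2 (a b : A) : dual (dual A ⊗ dual A) := tpair (ev A a) (ev A b).

Lemma ev2E a b (f g : dual A) : ev2 a b (tens f g) = f a * g b.
Proof. exact: tpairE. Qed.

Lemma ev2_sep (s t : dual A ⊗ dual A) :
  (forall a b, ev2 a b s = ev2 a b t) -> s = t.
Proof.
move=> h; case: (free_coords hA) => n [e [c ec]].
apply: (coords_sep (coords_tensor (coords_dual ec) (coords_dual ec))) => p.
exact: h.
Qed.

Lemma ev3_sep (s t : dual A ⊗ (dual A ⊗ dual A)) :
  (forall a b c, tpair (ev A a) (ev2 b c) s = tpair (ev A a) (ev2 b c) t) -> s = t.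
Proof.
move=> h; case: (free_coords hA) => n [e [c ec]].
have hc := coords_dual ec.
apply: (coords_sep (coords_tensor hc (coords_tensor hc hc))) => p.
exact: h.
Qed.

Lemma dual_comul_exists (alpha : dual A) :
  exists t : dual A ⊗ dual A, forall a b, ev2 a b t = alpha (amul a b).
Proof.
case: (free_coords hA) => n [e [c ec]].
pose l b := mk_linear ((amul_bilinear A).1 b).
pose r a := mk_linear ((amul_bilinear A).2 a).
exists (\sum_i \sum_j (alpha (amul (e i) (e j)) : K) *: tens (c i) (c j)) => a b.
have -> : amul a b =
    \sum_i \sum_j ((c i a : K) * (c j b : K)) *: amul (e i) (e j).
  rewrite {1}(ec a) -[LHS]/(l b _) linear_sum; apply: eq_bigr => i _.
  rewrite linearZZ -[l b _]/(r (e i) b) {1}(ec b) linear_sum scaler_sumr.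
  by apply: eq_bigr => j _; rewrite linearZZ scalerA.
rewrite !linear_sum; apply: eq_bigr => i _.
rewrite !linear_sum; apply: eq_bigr => j _.
by rewrite !linearZZ ev2E; apply: mulrC.
Qed.

(* The comultiplication of A^* is the unique map satisfying dual_comulE. *)
Definition dual_comul_fun (alpha : dual A) : dual A ⊗ dual A :=
  projT1 (cid (dual_comul_exists alpha)).

Lemma dual_comul_funE alpha a b :
  ev2 a b (dual_comul_fun alpha) = alpha (amul a b).
Proof. exact: (projT2 (cid (dual_comul_exists alpha))). Qed.

Fact dual_comul_linear : linear dual_comul_fun.
Proof.
move=> k alpha beta; apply: ev2_sep => a b.
by rewrite linearP !dual_comul_funE.
Qed.
Definition dual_comul : {linear dual A -> dual A ⊗ dual A} :=
  mk_linear dual_comul_linear.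

Lemma dual_comulE alpha a b : ev2 a b (dual_comul alpha) = alpha (amul a b).
Proof. exact: dual_comul_funE. Qed.

Fact dual_comulA alpha :
  tassoc _ _ _ (tmap dual_comul idfun (dual_comul alpha)) =
  tmap idfun dual_comul (dual_comul alpha).
Proof.
apply: ev3_sep => a b c.
have L x : tpair (ev A a) (ev2 b c) (tassoc _ _ _ (tmap dual_comul idfun x)) =
    ev2 (amul a b) c x.
  elim/tensor_ind: x => [|x y hx hy|f g]; first by rewrite !linear0.
    by rewrite !linearD hx hy.
  rewrite tmapE ev2E -dual_comulE; elim/tensor_ind: (dual_comul f) => [|x y hx hy|f1 f2].
  - rewrite linear0 mul0r.
    have -> : tens (0 : dual A ⊗ dual A) (idfun g) = 0.
      exact: (linear0 (mk_linear ((tens_bilinear _ _).1 g))).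
    by rewrite !linear0.
  - have -> : tens (x + y) (idfun g) = tens x (idfun g) + tens y (idfun g).
      exact: (linearD (mk_linear ((tens_bilinear _ _).1 g))).
    by rewrite !linearD hx hy mulrDl.
  - by rewrite tassocE tpairE !ev2E mulrA.
have R x : tpair (ev A a) (ev2 b c) (tmap idfun dual_comul x) =
    ev2 a (amul b c) x.
  elim/tensor_ind: x => [|x y hx hy|f g]; first by rewrite !linear0.
    by rewrite !linearD hx hy.
  by rewrite tmapE tpairE dual_comulE ev2E.
by rewrite L R !dual_comulE amulA.
Qed.

Definition dual_coalgebra : coalgebra K := Coalgebra dual_comulA.

End DualCoalgebra.

(* Main.v *)
Require Import Defs.
From HB Require Import structures.
From mathcomp Require Import all_boot all_algebra.
Import GRing.Theory.
Local Open Scope ring_scope.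

(** Non-degeneracy makes the left adjoint [a |-> (a, -)] of the pairing a linear
    bijection [A -> A^*]; by symmetry its inverse is [alpha |-> bar alpha].
    Invariance and symmetry then move a factor cyclically around a product:
    [alpha (a bar_beta b) = (a bar_beta b, bar_alpha) = (a bar_beta, b bar_alpha)
    = (b bar_alpha, a bar_beta) = (b bar_alpha a, bar_beta)
    = beta (b bar_alpha a)], which is the cyclic condition on the algebra.

    The claims on the coalgebra follow from this one. An element of [A^* ⊗ A^*]
    is determined by its values on pairs [(a, b)] because [A] is free of finite
    rank, and contracting the middle factor of the iterated comultiplication of
    [beta] with [x : A] gives the tensor whose value at [(a, b)] is [beta (a x b)]
    ([contract2_dual_comul3]). Evaluated this way, the cyclic condition on [A^*] is the one on [A]
    ([cyclic_algebra_dual_coalgebra]). Finally, on pure tensors, the condition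
    that [vhat (form_of bar)] commutes with the flip is again the cyclic condition
    on the coalgebra ([cyclic_form_of]). *)

Lemma form_ofE (K : comPzRingType) (M : coalgebra K)
    (bar : {linear M -> dual M}) (x y : M) :
  form_of bar (tens x y) = bar x y.
Proof. exact: tliftE. Qed.

Lemma vhat_form_of (K : comPzRingType) (M : coalgebra K)
    (bar : {linear M -> dual M}) (x y : M) :
  vhat (form_of bar) (tens x y) = contract2 (bar x) (comul3 M y).
Proof.
rewrite /vhat tliftE; congr (contract2 _ _).
by apply: dual_ext => z; apply: form_ofE.
Qed.

Lemma cyclic_form_of (K : comPzRingType) (M : coalgebra K)
    (bar : {linear M -> dual M}) :
  cyclic_coalgebra_structure bar -> cyclic_bilinear_form (form_of bar).
Proof.
move=> bar_cyclic; elim/tensor_ind => [|x y hx hy|x y].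
- by rewrite !linear0.
- by rewrite !linearD hx hy.
- by rewrite tflipE !vhat_form_of bar_cyclic.
Qed.

Section DualCoalgebra.
Variables (K : comPzRingType) (A : algebra K) (hA : free_finite_rank A).

Lemma ev2_tflip (a b : A) (t : dual A ⊗ dual A) :
  ev2 a b (tflip _ _ t) = ev2 b a t.
Proof.
elim/tensor_ind: t => [|s t hs ht|f g]; first by rewrite !linear0.
  by rewrite !linearD hs ht.
by rewrite tflipE !ev2E mulrC.
Qed.

(** Contracting the middle factor with [x] and then evaluating at [(a, b)] is
    evaluating at [(a, x, b)], hence the product [a x b] by the definition of the
    comultiplication. *)
Lemma contract2_dual_comul3 (a b x : A) (beta : dual A) :
  ev2 a b (contract2 (ev A x) (comul3 (dual_coalgebra hA) beta)) =
  beta (amul (amul a x) b).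
Proof.
have ev_contract (t : dual A ⊗ (dual A ⊗ dual A)) :
    ev2 a b (contract2 (ev A x) t) = tpair (ev A a) (ev2 x b) t.
  elim/tensor_ind: t => [|s t hs ht|f t]; first by rewrite !linear0.
    by rewrite !linearD hs ht.
  elim/tensor_ind: t => [|s t hs ht|g h].
  - have -> : tens f (0 : dual A ⊗ dual A) = 0.
      exact: (linear0 (mk_linear ((tens_bilinear _ _).2 f))).
    by rewrite !linear0.
  - have -> : tens f (s + t) = tens f s + tens f t.
      exact: (linearD (mk_linear ((tens_bilinear _ _).2 f))).
    by rewrite !linearD hs ht.
  - by rewrite contract2E linearZZ ev2E tpairE ev2E; apply: mulrCA.
have ev_comul (t : dual A ⊗ dual A) :
    tpair (ev A a) (ev2 x b) (tmap idfun (dual_comul hA) t) =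
    ev2 a (amul x b) t.
  elim/tensor_ind: t => [|s t hs ht|f g]; first by rewrite !linear0.
    by rewrite !linearD hs ht.
  by rewrite tmapE tpairE dual_comulE ev2E.
rewrite ev_contract -amulA -(dual_comulE hA); exact: ev_comul.
Qed.

Lemma cyclic_algebra_dual_coalgebra (bar : {linear dual A -> A}) :
  cyclic_algebra_structure bar ->
  @cyclic_coalgebra_structure K (dual_coalgebra hA) (ev A \o bar).
Proof.
move=> bar_cyclic alpha beta; apply: (ev2_sep hA) => a b.
by rewrite ev2_tflip !contract2_dual_comul3 bar_cyclic.
Qed.

End DualCoalgebra.

Lemma frobenius_bar (K : comPzRingType) (A : frobenius_algebra K)
    (A_symmetric : symmetric_frobenius A) :
  exists bar : {linear dual A -> A},
    forall (alpha : dual A) a, alpha a = pairing a (bar alpha).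
Proof.
have [bar adjK barK] := pairing_nondegenerate A.
have adj_linear : linear (left_adjoint (pairing_bilinear A)).
  by move=> k x y; apply: dual_ext => a; apply: (pairing_bilinear A).1.
have bar_linear : linear bar.
  by move=> k f g; apply: (can_inj adjK); rewrite adj_linear !barK.
exists (mk_linear bar_linear) => alpha a.
by rewrite A_symmetric -{1}(barK alpha).
Qed.

Lemma frobenius_representative_unique (K : comPzRingType) (A : frobenius_algebra K)
    (A_symmetric : symmetric_frobenius A)
    (x y : A) :
  (forall a, pairing a x = pairing a y) -> x = y.
Proof.
move=> xy; apply: (bij_inj (pairing_nondegenerate A)); apply: dual_ext => a.
by have /= := xy a; rewrite A_symmetric [RHS]A_symmetric.
Qed.

Lemma frobenius_cyclic (K : comPzRingType) (A : frobenius_algebra K)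
    (A_symmetric : symmetric_frobenius A)
    (bar : {linear dual A -> A}) :
  (forall (alpha : dual A) a, alpha a = pairing a (bar alpha)) ->
  cyclic_algebra_structure bar.
Proof.
move=> barP alpha beta a b.
rewrite barP [RHS]barP pairing_invariant A_symmetric.
by rewrite [RHS]pairing_invariant.
Qed.

Theorem theorem6p1 (K : comPzRingType) (A : frobenius_algebra K)
    (A_symmetric : symmetric_frobenius A) :
  (forall alpha : dual A,
     exists! x : A, forall a : A, alpha a = pairing a x) /\
  exists bar : {linear dual A -> A},
    (forall (alpha : dual A) (a : A), alpha a = pairing a (bar alpha)) /\
    cyclic_algebra_structure bar /\
    let M := dual_coalgebra (frob_free A) in
    let phi : {linear M -> dual M} := ev A \o bar in
    cyclic_coalgebra_structure phi /\
    cyclic_bilinear_form (form_of phi) /\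
    forall alpha beta : dual A,
      form_of phi (tens alpha beta) = beta (bar alpha) /\
      beta (bar alpha) = pairing (bar alpha) (bar beta).
Proof.
have [bar barP] := frobenius_bar K A A_symmetric.
split=> [alpha|].
  exists (bar alpha); split=> [//|x xP].
  apply: (frobenius_representative_unique K A A_symmetric) => a.
  by rewrite -barP xP.
have bar_cyclic := frobenius_cyclic K A A_symmetric bar barP.
have phi_cyclic := cyclic_algebra_dual_coalgebra K A (frob_free A) bar bar_cyclic.
exists bar; split=> //; split=> //=; split; first exact: phi_cyclic.
split; first exact: (cyclic_form_of _ _ _ phi_cyclic).
move=> alpha beta; split; last exact: barP.
exact: (form_ofE K (dual_coalgebra (frob_free A)) (ev A \o bar)).
Qed.
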